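(* Suppose that $0<a_k<\infty$ and $0<b_k<\infty$ for all $k\in\mathbb{N}$. Then there always exists the limit $$v_0:=-\lim_{k\to\infty}\frac{\alpha_k}{\beta_k}=-\Big(\frac1{a_1}+\frac{b_1}{a_1a_2}+\frac{b_1b_2}{a_1a_2a_3}+\cdots\Big)^{-1}\in(-a_1,0].$$ If $\mathcal{V}\neq\emptyset$, then $\inf\mathcal{V}=v_0\in\mathcal{V}$. Moreover, $v_0\in\mathcal{V}$ if and only if, for all $k\in\mathbb{N}$, $$v_0<\frac{b_1\cdots b_k-a_1\cdots a_k}{b_1\cdots b_{k-1}+b_1\cdots b_{k-2}\,a_k+\cdots+a_2\cdots a_k},$$ where the denominator is $\sum_{j=1}^{k}\big(\prod_{i=1}^{j-1}b_i\big)\big(\prod_{i=j+1}^{k}a_i\big)$, each of its $k$ terms being a product of $k-1$ factors.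
   Context: $\mathbb{N}=\{1,2,\dots\}$, $\mathbb{Z}_+=\{0,1,2,\dots\}$; convention $1/\infty:=0$; empty products equal $1$. Definitions: $\alpha_0=1$, $\beta_0=0$, and for $k\in\mathbb{N}$, $\alpha_k=\frac{a_1\cdots a_k}{b_1\cdots b_k}$ and $\beta_k=\frac1{b_k}+\frac{a_k}{b_kb_{k-1}}+\cdots+\frac{a_k\cdots a_2}{b_k\cdots b_1}$. $\mathcal{V}$ is the set of $v\in\mathbb{R}$ such that $\rho=\alpha+v\beta$ is admissible, i.e. $\rho_k=\alpha_k+v\beta_k\in(0,1)$ for all $k\in\mathbb{N}$ (equivalently, $\rho$ solves $(b_i+a_{i+1})\rho_i=a_i\rho_{i-1}+b_{i+1}\rho_{i+1}$ for $i\in\mathbb{N}$, $\rho_0=1$, with $\rho_k\in(0,1)$ for all $k\in\mathbb{N}$). *)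

(* Defs.v *)
From HB Require Import structures.
From mathcomp Require Import all_boot all_order all_algebra.
From mathcomp Require Import all_classical all_reals all_analysis.

Set Implicit Arguments.
Unset Strict Implicit.
Unset Printing Implicit Defensive.

Import Order.TTheory GRing.Theory Num.Theory.
Import numFieldNormedType.Exports.

Local Open Scope classical_set_scope.
Local Open Scope ring_scope.

(* The coefficients a_k, b_k are indexed by k >= 1: the values a 0 and b 0 are
   never used. *)

Definition alpha (R : realType) (a b : nat -> R) (k : nat) : R :=
  (\prod_(1 <= i < k.+1) a i) / (\prod_(1 <= i < k.+1) b i).

(* The j-th term is (a_k ... a_{j+1}) / (b_k ... b_j): j = k gives 1 / b_k and
   j = 1 gives (a_k ... a_2) / (b_k ... b_1). *)
Definition beta (R : realType) (a b : nat -> R) (k : nat) : R :=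
  \sum_(1 <= j < k.+1)
    (\prod_(j.+1 <= i < k.+1) a i) / (\prod_(j <= i < k.+1) b i).

Definition rho (R : realType) (a b : nat -> R) (v : R) (k : nat) : R :=
  alpha a b k + v * beta a b k.

Definition admissible (R : realType) (r : nat -> R) : Prop :=
  forall k : nat, (0 < k)%N -> 0 < r k < 1.

Definition Vset (R : realType) (a b : nat -> R) : set R :=
  [set v | admissible (rho a b v)].

(* At k = 0 the ratio is 1 / 0 = 0 by the convention for inverses in a field;
   this does not affect the limit. *)
Definition v0 (R : realType) (a b : nat -> R) : R :=
  - limn (fun k : nat => alpha a b k / beta a b k).

(* 1/a_1 + b_1/(a_1 a_2) + (b_1 b_2)/(a_1 a_2 a_3) + ..., possibly +oo. *)
Definition inv_series (R : realType) (a b : nat -> R) : \bar R :=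
  (\sum_(1 <= j <oo)
     ((\prod_(1 <= i < j) b i) / (\prod_(1 <= i < j.+1) a i))%R%:E)%E.

(* Main.v *)
Require Import Defs.
From HB Require Import structures.
From mathcomp Require Import all_boot all_order all_algebra.
From mathcomp Require Import all_classical all_reals all_analysis.
From mathcomp Require Import ring.

Import Order.TTheory GRing.Theory Num.Theory.
Import numFieldNormedType.Exports.

Local Open Scope classical_set_scope.
Local Open Scope ring_scope.

(** Everything rests on one factorisation: [beta k = alpha k * S k], where [S]
    is the sequence of partial sums of [1/a_1 + b_1/(a_1 a_2) + ...]: dividing
    [beta k] by [alpha k] leaves a sum whose terms do not depend on [k]
    ([beta_alpha]).  Hence [alpha k / beta k] is the inverse of [S k].  Since the
    terms are positive, [S] increases strictly, so for [k >= 1] the ratios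
    decrease to a limit [l >= 0], and [l] is the inverse of the sum of the
    series, infinite sum included ([rsum_inv_cvg]).

    The factorisation also turns admissibility into bounds on [v], for [k >= 1]:
    [rho k = alpha k * (1 + v * S k)] is positive iff [- (S k)^-1 < v]
    ([rho_gt0]), and [rho k < 1] iff [v < (1 - alpha k) / beta k], which is the
    bound of the last claim after multiplying numerator and denominator by
    [b_1 ... b_k] ([rho_lt1]).  Strict monotonicity makes [v0 = - l] lie
    strictly above every lower bound [- (S k)^-1], so only the upper bounds can
    exclude [v0]; and [v0] is the limit of the lower bounds, so no element of
    [Vset] is below it.  Upper bounds are inherited by smaller numbers, so one
    element of [Vset] already puts [v0] in it. *)

Section ReciprocalSeries.
Context {R : realType} (a b : nat -> R).
Hypothesis a_gt0 : forall k, (0 < k)%N -> 0 < a k.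
Hypothesis b_gt0 : forall k, (0 < k)%N -> 0 < b k.

Lemma prod_nat_gt0 (c : nat -> R) (m n : nat) :
  (forall k, (0 < k)%N -> 0 < c k) -> (0 < m)%N -> 0 < \prod_(m <= i < n) c i.
Proof.
move=> c_gt0 m_gt0; rewrite big_nat; apply: prodr_gt0 => i /andP[mi _].
exact/c_gt0/(leq_trans m_gt0).
Qed.

Definition rterm (j : nat) : R :=
  (\prod_(1 <= i < j) b i) / (\prod_(1 <= i < j.+1) a i).

(** The [k] in [rsum k] counts the terms, so that [rsum k] is paired with
    [alpha k] and [beta k]; the partial sums in [inv_series] are indexed by
    their exclusive upper bound instead. *)
Definition rsum (k : nat) : R := \sum_(1 <= j < k.+1) rterm j.

Lemma rterm_gt0 j : 0 < rterm j.
Proof. by rewrite divr_gt0 // prod_nat_gt0. Qed.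

Lemma rsum_ltS k : rsum k < rsum k.+1.
Proof. by rewrite /rsum [ltRHS]big_nat_recr //= ltrDl rterm_gt0. Qed.

Lemma rsum_nondecreasing : nondecreasing_seq rsum.
Proof. by apply/nondecreasing_seqP => k; exact/ltW/rsum_ltS. Qed.

Lemma rsum_gt0 k : (0 < k)%N -> 0 < rsum k.
Proof.
case: k => // k _; apply: le_lt_trans (rsum_ltS k).
by apply: sumr_ge0 => j _; exact/ltW/rterm_gt0.
Qed.

Lemma rsum1 : rsum 1 = (a 1)^-1.
Proof. by rewrite /rsum big_nat1 /rterm big_geq // big_nat1 mul1r. Qed.

Lemma alpha_gt0 k : 0 < alpha a b k.
Proof. by rewrite divr_gt0 // prod_nat_gt0. Qed.

(** Writing [a_{j+1} ... a_k] and [b_j ... b_k] as quotients of initial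
    products separates the dependence on [k] from the dependence on [j]. *)
Lemma beta_alpha k : beta a b k = alpha a b k * rsum k.
Proof.
rewrite /beta /alpha /rsum mulr_sumr; apply: eq_big_nat => j /andP[j1 jk].
rewrite /rterm (@big_cat_nat _ _ _ j.+1 1 k.+1) //=.
rewrite [\prod_(1 <= i < k.+1) b i](@big_cat_nat _ _ _ j) //=; last exact: ltnW.
by field; rewrite !gt_eqF ?prod_nat_gt0.
Qed.

Lemma beta_gt0 k : (0 < k)%N -> 0 < beta a b k.
Proof. by move=> k0; rewrite beta_alpha mulr_gt0 ?alpha_gt0 ?rsum_gt0. Qed.

Lemma alpha_div_beta k : alpha a b k / beta a b k = (rsum k)^-1.
Proof. by rewrite beta_alpha invfM mulrA divff ?mul1r // gt_eqF ?alpha_gt0. Qed.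

Lemma rho_gt0 v k : (0 < k)%N -> (0 < rho a b v k) = (- (rsum k)^-1 < v).
Proof.
move=> k0; rewrite /rho beta_alpha mulrCA -{1}[alpha a b k]mulr1 -mulrDr.
rewrite pmulr_rgt0 ?alpha_gt0 // -[(rsum k)^-1]mul1r -mulNr.
by rewrite ltr_pdivrMr ?rsum_gt0 // -[RHS]subr_gt0 opprK addrC.
Qed.

Lemma rho_lt1 v k : (0 < k)%N ->
  (rho a b v k < 1) =
  (v < (\prod_(1 <= i < k.+1) b i - \prod_(1 <= i < k.+1) a i) /
       (\sum_(1 <= j < k.+1)
          (\prod_(1 <= i < j) b i) * (\prod_(j.+1 <= i < k.+1) a i))).
Proof.
move=> k0; set B := \prod_(1 <= i < k.+1) b i.
have B0 : 0 < B by rewrite prod_nat_gt0.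
set A := \prod_(1 <= i < k.+1) a i.
have -> : \sum_(1 <= j < k.+1)
     (\prod_(1 <= i < j) b i) * (\prod_(j.+1 <= i < k.+1) a i) = B * beta a b k.
  rewrite /beta mulr_sumr; apply: eq_big_nat => j /andP[j1 jk].
  rewrite /B (@big_cat_nat _ _ _ j 1 k.+1) //=; last exact: ltnW.
  by field; rewrite gt_eqF ?prod_nat_gt0.
rewrite ltr_pdivlMr ?mulr_gt0 ?beta_gt0 // mulrCA ltrBrDl.
rewrite -[A](@divfK _ B) ?gt_eqF // -[A / B]/(alpha a b k) [_ * B]mulrC -mulrDr.
by rewrite -[X in _ = (_ < X)]mulr1 ltr_pM2l.
Qed.

(** When the partial sums stay bounded their limit is positive and inversion is
    continuous there; otherwise they tend to [+oo] and their inverses to [0],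
    which is the inverse of [+oo] in the extended reals. *)
Lemma rsum_inv_cvg :
  exists l : R, (fun k => (rsum k)^-1) @ \oo --> l /\
                l%:E = (limn (EFin \o rsum))^-1%E.
Proof.
have [cS|dS] := pselect (cvgn rsum).
  have lim_gt0 : 0 < limn rsum.
    apply: lt_le_trans (rsum_gt0 1 isT) _.
    exact: nondecreasing_cvgn_le rsum_nondecreasing cS 1%N.
  exists (limn rsum)^-1; split; first by apply: cvgV => //; rewrite gt_eqF.
  by rewrite EFin_lim // inver gt_eqF.
have Soo := nondecreasing_dvgn_lt rsum_nondecreasing dS.
exists 0; split.
  apply/gtr0_cvgV0 => //; near=> k; apply: rsum_gt0.
  by near: k; exact: nbhs_infty_gt.
suff -> : limn (EFin \o rsum) = +oo%E by rewrite invey.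
by apply: cvg_lim => //; exact/cvgeryP.
Unshelve. all: by end_near. Qed.

Lemma inv_seriesE : inv_series a b = limn (EFin \o rsum).
Proof.
have -> : EFin \o rsum = [sequence (\sum_(1 <= j < k.+1) (rterm j)%:E)%E]_k.
  by apply/funext => k /=; rewrite sumEFin.
apply/esym/cvg_lim => //.
rewrite (cvg_shiftS (fun n => \sum_(1 <= j < n) (rterm j)%:E)%E).
by apply: is_cvg_nneseries => j _ _; rewrite lee_fin ltW ?rterm_gt0.
Qed.

(** The inequality is strict because every term of the series is positive: the
    limit is already at most [(rsum k.+1)^-1], which is smaller than the right
    side.  This is what makes the positivity of [rho] at [v0] automatic. *)
Lemma rsum_inv_lim_lt (l : R) k : (fun k => (rsum k)^-1) @ \oo --> l ->
  (0 < k)%N -> l < (rsum k)^-1.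
Proof.
move=> cl k0; apply: (@le_lt_trans _ _ (rsum k.+1)^-1); last first.
  by rewrite ltf_pV2 ?posrE ?rsum_gt0 // rsum_ltS.
rewrite -(cvg_lim _ cl) //; apply: limr_le; first by apply/cvg_ex; exists l.
near=> n; rewrite lef_pV2 ?posrE ?rsum_gt0 //.
  by apply: rsum_nondecreasing; near: n; exact: nbhs_infty_gt.
by near: n; exact: nbhs_infty_gt.
Unshelve. all: by end_near. Qed.

Lemma rsum_inv_lim_ge0 (l : R) :
  (fun k => (rsum k)^-1) @ \oo --> l -> 0 <= l.
Proof.
move=> cl; rewrite -(cvg_lim _ cl) //; apply: limr_ge.
  by apply/cvg_ex; exists l.
near=> n; rewrite invr_ge0; apply/ltW/rsum_gt0.
by near: n; exact: nbhs_infty_gt.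
Unshelve. all: by end_near. Qed.

Lemma Vset_ge_lim (l v : R) :
  (fun k => (rsum k)^-1) @ \oo --> l -> Vset a b v -> - l <= v.
Proof.
move=> cl Vv; rewrite lerNl -(cvg_lim _ cl) //; apply: limr_ge.
  by apply/cvg_ex; exists l.
near=> n; have n0 : (0 < n)%N by near: n; exact: nbhs_infty_gt.
by have /andP[+ _] := Vv n n0; rewrite rho_gt0 // lerNl => /ltW.
Unshelve. all: by end_near. Qed.

End ReciprocalSeries.

(* The inverse below is taken in \bar R, where (+oo)^-1 = 0. *)
Theorem proposition1p7 (R : realType) (a b : nat -> R)
    (ha : forall k : nat, (0 < k)%N -> 0 < a k)
    (hb : forall k : nat, (0 < k)%N -> 0 < b k) :
  [/\ cvgn (fun k : nat => alpha a b k / beta a b k),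
      (v0 a b)%:E = (- (inv_series a b)^-1)%E,
      - a 1%N < v0 a b <= 0,
      Vset a b !=set0 ->
        [/\ has_inf (Vset a b), inf (Vset a b) = v0 a b & Vset a b (v0 a b)]
    & Vset a b (v0 a b) <->
        (forall k : nat, (0 < k)%N ->
           v0 a b <
             (\prod_(1 <= i < k.+1) b i - \prod_(1 <= i < k.+1) a i) /
             (\sum_(1 <= j < k.+1)
                (\prod_(1 <= i < j) b i) * (\prod_(j.+1 <= i < k.+1) a i)))].
Proof.
have [l [cl lE]] := rsum_inv_cvg a b ha hb.
have ratioE : (fun k => alpha a b k / beta a b k) = (fun k => (rsum a b k)^-1).
  by apply/funext => k; exact: alpha_div_beta.
have v0E : v0 a b = - l by rewrite /v0 ratioE (cvg_lim _ cl).
have v0_rho_gt0 k : (0 < k)%N -> 0 < rho a b (v0 a b) k.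
  by move=> k0; rewrite rho_gt0 // v0E ltrN2 rsum_inv_lim_lt.
have v0_lb : lbound (Vset a b) (v0 a b).
  by move=> v Vv; rewrite v0E; exact: Vset_ge_lim cl Vv.
split.
- by rewrite ratioE; apply/cvg_ex; exists l.
- by rewrite v0E EFinN lE inv_seriesE.
- rewrite v0E ltrN2 oppr_le0 (rsum_inv_lim_ge0 a b) // andbT.
  by rewrite -[a 1%N]invrK -(rsum1 a b) rsum_inv_lim_lt.
- move=> [v Vv].
  have V0 : Vset a b (v0 a b).
    move=> k k0; rewrite v0_rho_gt0 //=.
    have /andP[_] := Vv k k0; apply: le_lt_trans.
    by rewrite lerD2l ler_wpM2r ?v0_lb // ltW // beta_gt0.
  split=> //; first by split; [exists v | exists (v0 a b)].
  apply/le_anti/andP; split; last by apply: lb_le_inf => //; exists v.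
  by apply: ge_inf => //; exists (v0 a b).
- split=> [V0 k k0|ub k k0].
    by have /andP[_] := V0 k k0; rewrite rho_lt1.
  by rewrite v0_rho_gt0 //= rho_lt1 // ub.
Qed.
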